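(* Let $k$ be an integer and $m$ a positive integer. For every $i=0,\ldots,m-1$ let $$c_m(i)=\frac{m^2+m-2i}{(m-i)(m+1-i)}\binom{m+1-i}{i}\quad\text{and}\quad d_m(i)=\frac{m}{m-i}\binom{m-i}{i},$$ and in addition let $c_1(1)=4$. Then $c_m(i)\in\mathbb Z$ and $d_m(i)\in\mathbb Z$ for every $i=0,\ldots,m-1$. Moreover, $$\sum_{i=0}^{\lfloor (m+1)/2\rfloor}(-1)^i c_m(i)\genfrac{[}{]}{0pt}{}{n-2i}{k-i}_m=2(-1)^k\delta_{m,\,n}$$ for each integer $n\ge 2\lfloor (m+1)/2\rfloor$, and $$\sum_{i=0}^{\lfloor m/2\rfloor}(-1)^i d_m(i)\genfrac{\{}{\}}{0pt}{}{n-2i}{k-i}_m=(-1)^k\delta_{m-1,\,n}$$ for any integer $n\ge 2\lfloor m/2\rfloor$.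
   Context: For a positive integer $m$, a nonnegative integer $n$ and an integer $r$, define $$\genfrac{[}{]}{0pt}{}{n}{r}_m=\sum_{\substack{0\le k\le n\\ k\equiv r\ (\mathrm{mod}\ m)}}\binom nk,\qquad \genfrac{\{}{\}}{0pt}{}{n}{r}_m=\sum_{\substack{0\le k\le n\\ k\equiv r\ (\mathrm{mod}\ m)}}(-1)^{(k-r)/m}\binom nk .$$ The Kronecker symbol $\delta_{a,b}$ is $1$ if $a=b$ and $0$ otherwise. $\lfloor\alpha\rfloor$ is the integral part (floor) of the real number $\alpha$. *)

(* Defs.v *)
From HB Require Import structures.
From mathcomp Require Import all_boot all_order all_algebra.

Set Implicit Arguments.
Unset Strict Implicit.
Unset Printing Implicit Defensive.

Import Order.TTheory GRing.Theory Num.Theory.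
Local Open Scope ring_scope.

Definition binom_sum_mod (m n : nat) (r : int) : nat :=
  (\sum_(0 <= j < n.+1 | (j%:Z == r %[mod m%:Z])%Z) 'C(n, j))%N.

(* [(-1) ^ _] is the power with [int] exponent in the unit ring [int]; the
   division by [m] is exact on the terms selected by the congruence. *)
Definition alt_binom_sum_mod (m n : nat) (r : int) : int :=
  \sum_(0 <= j < n.+1 | (j%:Z == r %[mod m%:Z])%Z)
    (-1) ^ ((j%:Z - r) %/ m%:Z)%Z * ('C(n, j))%:Z.

(* Rational-valued, since integrality is not apparent from the formulas, which
   are meant for [i < m]; the only other value in use is [c_coef 1 1 = 4].  The
   subtractions outside the binomials are taken in [rat], not in [nat]. *)
Definition c_coef (m i : nat) : rat :=
  if (m == 1%N) && (i == 1%N) then 4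
  else (m%:R ^+ 2 + m%:R - 2 * i%:R)
         / ((m%:R - i%:R) * (m%:R + 1 - i%:R)) * ('C(m + 1 - i, i))%:R.

Definition d_coef (m i : nat) : rat :=
  m%:R / (m%:R - i%:R) * ('C(m - i, i))%:R.

(* Main.v *)
Require Import Defs.
From HB Require Import structures.
From mathcomp Require Import all_boot all_order all_algebra.
From mathcomp Require Import zify ring.

Set Implicit Arguments.
Unset Strict Implicit.
Unset Printing Implicit Defensive.

Import Order.TTheory GRing.Theory Num.Theory.
Local Open Scope ring_scope.

(** Both families of sums are values of a linear form on polynomials.  For a
    nonzero [eps] let [W r p] be the sum of [eps ^ ((j - r) / m) * p`_j] over the
    [j] congruent to [r] modulo [m].  Then [W r] sends [(1 + 'X) ^+ n] to the
    plain sum of binomials when [eps = 1], and to the alternating one when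
    [eps = -1].  Multiplying by ['X] shifts the residue ([residue_formXM]), so
    the left-hand sides of the theorem are [W k] applied to the sum over [i] of
    [(-1) ^+ i * c_m(i)] (or [d_m(i)]) times ['X^i * (1 + 'X) ^+ (n - 2 * i)].
    Shifting by a whole period multiplies by [eps], so [W k] vanishes on the
    multiples of ['X^m - eps] ([residue_form_kill]).

    The coefficients are made for this.  The [d_m(i)] are the coefficients in
    Waring's expression of a power sum through [x * y] and [x + y],
    [x ^+ m + y ^+ m = \sum_i (-1) ^+ i * d_m(i) * (x * y) ^+ i
                                * (x + y) ^+ (m - 2 * i)],
    and the [c_m(i)] are those of [(y ^+ m - x ^+ m) * (y - x)], which is a
    combination of the power sums of orders [m + 1] and [m - 1].  Both families
    come from Lucas' recurrence, which makes them integers.  At [x = 1] and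
    [y = 'X] the two expansions are ['X^m + 1] and [('X^m - 1) * ('X - 1)], so
    [W k] kills them and all their multiples by powers of [1 + 'X]
    ([residue_sum_vanish]).

    This covers every [n] at least the degree [e] of the expansion ([e = m + 1]
    for [c], [e = m] for [d]).  The bound on [n] admits one more value, [n =
    e - 1], and only if [e] is odd.  The polynomial is then the expansion
    divided by [1 + 'X], and [eps = (-1) ^+ m] in both families.  Up to sign,
    ['X^m - eps] divided by [1 + 'X] is the sum of the [(- 'X) ^+ j] with
    [j < m]; exactly one [j < m] is congruent to [k], and the signs combine to
    make its contribution [(-1) ^ k] ([residue_form_alt]).  This gives the
    Kronecker deltas; the factor ['X - 1] doubles the first of them. *)

(** * Lucas coefficients and Waring's formula *)

(** The coefficients [d_m(i)], generated by the recurrence of the power sums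
    [p_m = x ^+ m + y ^+ m], namely
    [p_(m+2) = (x + y) * p_(m+1) - x * y * p_m].  The first value is [2] because
    [p_0 = 2]. *)
Fixpoint lucas_coef (m i : nat) : nat :=
  match m, i with
  | 0, 0 => 2
  | _.+1, 0 => 1
  | (m'.+1 as m1).+1, i'.+1 => lucas_coef m1 i + lucas_coef m' i'
  | _, _.+1 => 0
  end.

Lemma lucas_coefSS (m i : nat) :
  lucas_coef m.+2 i.+1 = (lucas_coef m.+1 i.+1 + lucas_coef m i)%N.
Proof. by []. Qed.

Lemma lucas_coefS0 (m : nat) : lucas_coef m.+1 0 = 1%N.
Proof. by case: m. Qed.

Lemma two_step_ind (P : nat -> Prop) :
  P 0 -> P 1 -> (forall n, P n -> P n.+1 -> P n.+2) -> forall n, P n.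
Proof.
move=> P0 P1 PSS n; suff [] : P n /\ P n.+1 by [].
by elim: n => [//|n [Pn Pn1]]; split; last exact: PSS.
Qed.

Lemma lucas_coef_small (m i : nat) : (m < 2 * i)%N -> lucas_coef m i = 0%N.
Proof.
elim/two_step_ind: m i => [||m IH0 IH1] [|i] // lt_mi.
by rewrite lucas_coefSS IH1 ?IH0 //; lia.
Qed.

(** The division-free form of [d_m(i) = m / (m - i) * 'C(m - i, i)].  Beyond the
    middle both sides vanish; below it the recurrence reduces the claim to
    Pascal's rule and [(i + 1) * 'C(a, i + 1) = (a - i) * 'C(a, i)] with
    [a = m - i]. *)
Lemma lucas_coef_bin (m i : nat) :
  ((m - i) * lucas_coef m i = m * 'C(m - i, i))%N.
Proof.
elim/two_step_ind: m i => [|[|i]|m IH0 IH1] //; case=> [|i].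
- by rewrite bin0 subn0.
have [lt_mi|le_im] := ltnP m (2 * i).
  by rewrite lucas_coef_small ?bin_small; lia.
case: (posnP m) => [m0|m_gt0]; first by move: le_im; rewrite m0; case: i.
have [a defm] : exists a, m = (a + i)%N by exists (m - i)%N; lia.
have a_gt0 : (0 < a)%N by lia.
have := IH0 i; have := IH1 i.+1; have := mul_bin_left a i.
rewrite lucas_coefSS subSS defm addnK.
have -> : ((a + i).+2 - i.+1 = a.+1)%N by lia.
rewrite binS.
have [b defa] : exists b, a = (b + i)%N by exists (a - i)%N; lia.
rewrite defa addnK -defa => hbin h1 h0.
(* The hypotheses for [m] and [m.+1] both give their coefficient times [a]. *)
apply/eqP; rewrite -(eqn_pmul2l a_gt0); apply/eqP.
rewrite mulnCA [(a * (_ + _))%N]mulnDr h1 h0.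
nia.
Qed.

(** Both sides satisfy the recurrence of the power sums.  The range may be any
    one reaching the middle, so that a single [N] serves the three orders that
    the recurrence involves. *)
Lemma waring_lucas (R : comPzRingType) (x y : R) (m N : nat) :
  (m %/ 2 < N)%N ->
  \sum_(0 <= i < N)
     (-1) ^+ i * (lucas_coef m i)%:R * ((x * y) ^+ i * (x + y) ^+ (m - 2 * i))
  = x ^+ m + y ^+ m.
Proof.
elim/two_step_ind: m N => [||m IH0 IH1] [|N] // ltmN.
- rewrite big_nat_recl // big1 ?addr0 => [|i _]; last by rewrite mulr0 mul0r.
  by rewrite /= !expr0 !mul1r mulr1.
- rewrite big_nat_recl // big1 ?addr0 => [|i _]; last by rewrite mulr0 mul0r.
  by rewrite /= !expr0 !mul1r !expr1.
have -> : x ^+ m.+2 + y ^+ m.+2 =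
    (x + y) * (x ^+ m.+1 + y ^+ m.+1) - x * y * (x ^+ m + y ^+ m).
  by rewrite !exprS; ring.
rewrite -(IH1 N.+1) -?(IH0 N); try lia.
rewrite !big_nat_recl // mulrDr -addrA; congr (_ + _).
  by rewrite !lucas_coefS0 !expr0 !muln0 !subn0 !mul1r exprS.
rewrite !mulr_sumr -sumrB; apply: eq_bigr => i _.
rewrite lucas_coefSS natrD.
have -> : (m.+2 - 2 * i.+1 = m - 2 * i)%N by lia.
(* Past the middle the exponent [m.+1 - 2 * i.+1] is truncated, but then its
   coefficient is zero. *)
have [lt_mi|le_im] := ltnP m.+1 (2 * i.+1).
  by rewrite (lucas_coef_small lt_mi) !exprS; ring.
have -> : (m - 2 * i = (m.+1 - 2 * i.+1).+1)%N by lia.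
by rewrite !exprS; ring.
Qed.

(** The coefficients [c_m(i)]: those of [p_(m+1) - x * y * p_(m-1)], where [p_n]
    is the power sum of order [n].  The exceptional value [c_1(1) = 4] is
    [2 + 2], the second term coming from [p_0 = 2]. *)
Definition lucas_coef2 (m i : nat) : nat :=
  lucas_coef m.+1 i + (if i is i'.+1 then lucas_coef m.-1 i' else 0).

(** Expanding the product gives [p_(m+1) - x * y * p_(m-1)], to which Waring's
    formula applies twice. *)
Lemma waring_lucas2 (R : comPzRingType) (x y : R) (m N : nat) :
  (0 < m)%N -> ((m + 1) %/ 2 < N)%N ->
  \sum_(0 <= i < N)
     (-1) ^+ i * (lucas_coef2 m i)%:R
       * ((x * y) ^+ i * (x + y) ^+ (m.+1 - 2 * i))
  = (y ^+ m - x ^+ m) * (y - x).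
Proof.
case: m => // m _; case: N => // N ltmN.
have -> : (y ^+ m.+1 - x ^+ m.+1) * (y - x) =
    (x ^+ m.+2 + y ^+ m.+2) - x * y * (x ^+ m + y ^+ m).
  by rewrite !exprS; ring.
rewrite -(@waring_lucas _ x y m.+2 N.+1) -?(@waring_lucas _ x y m N); try lia.
rewrite !big_nat_recl // /lucas_coef2 addn0 -addrA; congr (_ + _).
rewrite mulr_sumr -sumrB; apply: eq_bigr => i _.
rewrite natrD /=.
have -> : (m.+2 - 2 * i.+1 = m - 2 * i)%N by lia.
by rewrite !exprS; ring.
Qed.

(** The closed forms of the two summands involve ['C(m + 1 - i, i)] and
    ['C(m - i, i - 1)], and the second binomial is [i / (m + 1 - i)] times the
    first.  The term [2 * i] is moved to the left to avoid truncation. *)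
Lemma lucas_coef2_bin (m i : nat) : (i < m)%N ->
  ((m - i) * (m + 1 - i) * lucas_coef2 m i + 2 * i * 'C(m + 1 - i, i)
   = (m ^ 2 + m) * 'C(m + 1 - i, i))%N.
Proof.
case: i => [|i] lt_im.
  by rewrite /lucas_coef2 lucas_coefS0 !subn0 bin0; nia.
have [a defm] : exists a, m = (a + i).+1 by exists (m - i.+1)%N; lia.
have := lucas_coef_bin m.+1 i.+1; have := lucas_coef_bin m.-1 i.
have := mul_bin_diag a.+1 i; rewrite /lucas_coef2 {lt_im}defm /=.
have -> : ((a + i).+1 - i.+1 = a)%N by lia.
have -> : ((a + i).+1 + 1 - i.+1 = a.+1)%N by lia.
have -> : ((a + i).+2 - i.+1 = a.+1)%N by lia.
rewrite addnK => hbin h1 h2.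
rewrite mulnDr (mulnAC a) [in X in (X + _ + _)%N]mulnC.
move: h1 h2 hbin; nia.
Qed.

(** * The rational coefficients of the theorem *)

Lemma d_coefE (m i : nat) : (i < m)%N -> d_coef m i = (lucas_coef m i)%:R.
Proof.
move=> lt_im; rewrite /d_coef -natrB 1?ltnW //.
have nz : (m - i)%:R != 0 :> rat by rewrite pnatr_eq0; lia.
apply: (mulfI nz).
by rewrite mulrA mulrCA mulfV // mulr1 -!natrM lucas_coef_bin.
Qed.

Lemma c_coefE (m i : nat) :
  (i < m)%N || (m == 1%N) && (i == 1%N) -> c_coef m i = (lucas_coef2 m i)%:R.
Proof.
rewrite /c_coef; case: ifP => [/andP[/eqP-> /eqP->] //|_]; rewrite orbF => lt_im.
have nz1 : m%:R - i%:R != 0 :> rat by rewrite -natrB ?pnatr_eq0; lia.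
have nz2 : m%:R + 1 - i%:R != 0 :> rat.
  by rewrite natr1 -natrB ?pnatr_eq0; lia.
have := congr1 (fun n => n%:R : rat) (lucas_coef2_bin lt_im).
move: (lucas_coef2 m i) ('C(_, _)) => c B /=.
rewrite !(natrD, natrM, natrX) !natrB ?natrD => [h||]; try lia.
apply: (mulfI (mulf_neq0 nz1 nz2)); rewrite -[RHS](addrK (2 * i%:R * B%:R)) h.
by field; rewrite nz1 nz2.
Qed.

(** * Weighted sums of coefficients over a residue class *)

Section ResidueForm.
Variables (F : fieldType) (m : nat) (eps : F).

(** A function of [j] supported on one class modulo [m] and multiplied by [eps]
    at each step of length [m]; it depends only on [j - r]. *)
Definition residue_weight (r : int) (j : nat) : F :=
  if (j%:Z == r %[mod m%:Z])%Z then eps ^ ((j%:Z - r) %/ m%:Z)%Z else 0.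

Definition residue_form (r : int) (p : {poly F}) : F :=
  \sum_(0 <= j < size p) residue_weight r j * p`_j.

Lemma residue_form_widen (r : int) (p : {poly F}) (N : nat) :
  (size p <= N)%N ->
  residue_form r p = \sum_(0 <= j < N) residue_weight r j * p`_j.
Proof.
move=> le_pN; rewrite (big_cat_nat _ le_pN) //= [X in _ + X]big_nat.
rewrite [X in _ + X]big1 ?addr0 // => j /andP[le_pj _].
by rewrite nth_default ?mulr0.
Qed.

Fact residue_form_is_linear (r : int) : linear_for *%R (residue_form r).
Proof.
move=> a p q; pose N := maxn (size (a *: p + q)) (maxn (size p) (size q)).
rewrite !(@residue_form_widen _ _ N) ?leq_max ?leqnn ?orbT //.
rewrite big_distrr -big_split /=; apply: eq_bigr => j _.
by rewrite coefD coefZ; ring.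
Qed.
HB.instance Definition _ (r : int) :=
  GRing.isLinear.Build F {poly F} F *%R (residue_form r)
    (residue_form_is_linear r).

Lemma residue_formXM (r : int) (p : {poly F}) :
  residue_form r ('X * p) = residue_form (r - 1) p.
Proof.
rewrite (@residue_form_widen _ ('X * p) (size p).+1); last first.
  by apply/leq_sizeP => -[//|j] lt_pj; rewrite coefXM nth_default.
rewrite big_nat_recl // coefXM mulr0 add0r; apply: eq_bigr => j _.
rewrite coefXM /=; congr (_ * _); rewrite /residue_weight.
have -> : (j.+1%:Z - r = j%:Z - (r - 1)) by lia.
by rewrite !eqz_mod_dvd; have -> : (j.+1%:Z - r = j%:Z - (r - 1)) by lia.
Qed.

Lemma residue_formXnM (r : int) (i : nat) (p : {poly F}) :
  residue_form r ('X^i * p) = residue_form (r - i%:Z) p.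
Proof.
elim: i r => [|i IH] r; first by rewrite mul1r subr0.
by rewrite exprS -mulrA residue_formXM IH; congr residue_form; lia.
Qed.

Lemma residue_form_period (r : int) (p : {poly F}) :
  (0 < m)%N -> eps != 0 -> residue_form (r - m%:Z) p = eps * residue_form r p.
Proof.
move=> m_gt0 eps_nz; rewrite /residue_form mulr_sumr; apply: eq_bigr => j _.
rewrite mulrA; congr (_ * _); rewrite /residue_weight.
have mz : m%:Z != 0 by lia.
rewrite !eqz_mod_dvd.
have -> : j%:Z - (r - m%:Z) = 1 * m%:Z + (j%:Z - r) by lia.
rewrite divzMDl // rpredDl ?dvdz_mull //; case: ifP; rewrite ?mulr0 // => _.
by rewrite expfzDr // expr1z.
Qed.

(** Multiplying [p] by ['X^m] or by [eps] has the same effect on the form. *)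
Lemma residue_form_kill (r : int) (p : {poly F}) :
  (0 < m)%N -> eps != 0 -> residue_form r (('X^m - eps%:P) * p) = 0.
Proof.
move=> m_gt0 eps_nz; rewrite mulrBl linearB /= residue_formXnM mul_polyC.
by rewrite linearZ /= residue_form_period // subrr.
Qed.

Lemma residue_form_binomial (r : int) (n : nat) :
  residue_form r ((1 + 'X) ^+ n)
  = \sum_(0 <= j < n.+1) residue_weight r j * 'C(n, j)%:R.
Proof.
have coef1X j : ((1 + 'X) ^+ n : {poly F})`_j = 'C(n, j)%:R.
  rewrite exprDn coef_sum.
  under eq_bigr => i _ do rewrite expr1n mul1r coefMn coefXn.
  have [le_jn|lt_nj] := leqP j n.
    rewrite (bigD1 (Ordinal (le_jn : (j < n.+1)%N))) //= eqxx.
    rewrite big1 ?addr0 // => i; rewrite eq_sym -val_eqE /= => /negPf->.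
    by rewrite mul0rn.
  rewrite bin_small // big1 // => i _.
  by rewrite gtn_eqF ?mul0rn // (leq_ltn_trans _ lt_nj) // -ltnS.
rewrite (@residue_form_widen _ _ n.+1).
  by apply: eq_bigr => j _; rewrite coef1X.
by apply/leq_sizeP => j lt_nj; rewrite coef1X bin_small.
Qed.

Lemma residue_form_sum (a : nat -> F) (N n : nat) (k : int) :
  \sum_(0 <= i < N) a i * residue_form (k - i%:Z) ((1 + 'X) ^+ (n - 2 * i))
  = residue_form k (\sum_(0 <= i < N) a i *: ('X^i * (1 + 'X) ^+ (n - 2 * i))).
Proof.
rewrite linear_sum; apply: eq_bigr => i _.
by rewrite linearZ /= residue_formXnM.
Qed.

(** Since [2 * N <= n] keeps the exponents from being truncated, changing [n]
    multiplies the sum by a power of [1 + 'X]. *)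
Lemma expansion_raise (a : nat -> F) (N n d : nat) : (2 * N <= n)%N ->
  (\sum_(0 <= i < N.+1) a i *: ('X^i * (1 + 'X) ^+ (n + d - 2 * i)) : {poly F})
  = (1 + 'X) ^+ d
    * \sum_(0 <= i < N.+1) a i *: ('X^i * (1 + 'X) ^+ (n - 2 * i)).
Proof.
move=> leNn; rewrite mulr_sumr [LHS]big_nat [RHS]big_nat.
apply: eq_bigr => i /andP[_ lt_iN].
have -> : (n + d - 2 * i = d + (n - 2 * i))%N by lia.
by rewrite exprD -scalerAr mulrCA.
Qed.

(** The sum for [n] is the form of a multiple of the expansion of order [e],
    hence of ['X^m - eps]. *)
Lemma residue_sum_vanish (a : nat -> F) (N e n : nat) (T : {poly F}) (k : int) :
  (0 < m)%N -> eps != 0 -> (2 * N <= e <= n)%N ->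
  \sum_(0 <= i < N.+1) a i *: ('X^i * (1 + 'X) ^+ (e - 2 * i))
    = ('X^m - eps%:P) * T ->
  \sum_(0 <= i < N.+1)
    a i * residue_form (k - i%:Z) ((1 + 'X) ^+ (n - 2 * i)) = 0.
Proof.
move=> m_gt0 eps_nz /andP[leNe le_en] def_e.
rewrite residue_form_sum -(subnKC le_en) (expansion_raise _ _ leNe) def_e mulrCA.
exact: residue_form_kill.
Qed.

(** The quotient of [1 - (- 'X) ^+ m] by [1 + 'X]. *)
Definition alt_poly : {poly F} := \sum_(0 <= j < m) (-1) ^+ j *: 'X^j.

Lemma alt_polyM : (1 + 'X) * alt_poly = 1 - (-1) ^+ m *: 'X^m.
Proof.
rewrite /alt_poly; elim: m => [|n IH].
  by rewrite big_nil mulr0 !expr0 scale1r subrr.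
rewrite big_nat_recr //= mulrDr IH !exprS mulrDl mul1r -scalerAr mulN1r scaleNr.
by rewrite opprK addrA subrK.
Qed.

(** For this [eps] the weight of a [j] in the class of [k] is [(-1) ^ (j - k)],
    which the sign of the coefficient of ['X^j] turns into [(-1) ^ k]; and that
    class has exactly one member below [m]. *)
Lemma residue_form_alt (k : int) : (0 < m)%N -> eps = (-1) ^+ m ->
  residue_form k alt_poly = (-1) ^ k.
Proof.
move=> m_gt0 defe; rewrite linear_sum /=.
have m_nz : m%:Z != 0 by lia.
have weightX j : residue_form k ('X^j) = residue_weight k j.
  rewrite (@residue_form_widen _ _ j.+1) ?size_polyXn // big_nat_recr //=.
  rewrite coefXn eqxx mulr1 big_nat big1 ?add0r // => i /andP[_ lt_ij].
  by rewrite coefXn ltn_eqF ?mulr0.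
have sgnE j : (-1) ^+ j * residue_weight k j =
    if (j%:Z == k %[mod m%:Z])%Z then (-1) ^ k else 0.
  rewrite /residue_weight; case: ifP; rewrite ?mulr0 // eqz_mod_dvd => dv.
  have N1_nz : (-1 : F) != 0 by rewrite oppr_eq0 oner_neq0.
  rewrite defe !exprnP exprz_exp [m%:Z * _]mulrC divzK // expfzDr // mulrA.
  by rewrite -expfzMl mulrNN mulr1 exp1rz mul1r -exprz_inv invrN1.
under eq_bigr => j _ do rewrite linearZ /= weightX sgnE.
rewrite -big_mkcond /=.
have [j0 lt_j0 defj0] : exists2 j0, (j0 < m)%N & (k %% m%:Z)%Z = j0%:Z.
  exists `|(k %% m%:Z)%Z|%N; last by rewrite gez0_abs ?modz_ge0.
  by have := ltz_pmod k (_ : 0 < m%:Z); have := modz_ge0 k m_nz; lia.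
rewrite big_nat_cond (eq_bigl (fun j => (0 <= j < m)%N && (j == j0))).
  by rewrite -big_nat_cond big_nat1_eq lt_j0.
move=> j /=; case lt_jm: (j < m)%N => //=.
by rewrite defj0 modz_small ?eqz_nat //; lia.
Qed.

(** One order below the expansion the polynomial is its quotient by [1 + 'X],
    and ['X^m - eps] is [- eps] times [1 - (- 'X) ^+ m] since [eps] is a sign. *)
Lemma residue_sum_boundary (a : nat -> F) (N e : nat) (T : {poly F}) (k : int) :
  (0 < m)%N -> eps = (-1) ^+ m -> (2 * N <= e)%N ->
  \sum_(0 <= i < N.+1) a i *: ('X^i * (1 + 'X) ^+ (e.+1 - 2 * i))
    = ('X^m - eps%:P) * T ->
  \sum_(0 <= i < N.+1)
    a i * residue_form (k - i%:Z) ((1 + 'X) ^+ (e - 2 * i))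
  = - eps * residue_form k (alt_poly * T).
Proof.
move=> m_gt0 defe leNe.
rewrite -[e.+1]addn1 (expansion_raise _ _ leNe) expr1 => def_e.
rewrite residue_form_sum -linearZ; congr (residue_form k _).
have X1_nz : (1 + 'X : {poly F}) != 0.
  by rewrite addrC -size_poly_eq0 size_XaddC.
apply: (mulfI X1_nz); rewrite def_e -scalerAr mulrA alt_polyM -defe.
rewrite scalerAl; congr (_ * _); rewrite scalerBr scalerA alg_polyC.
by rewrite mulNr defe -expr2 sqrr_sign polyCN scaleN1r opprK addrC.
Qed.

End ResidueForm.

Lemma binom_sum_mod_form (m n : nat) (r : int) :
  (binom_sum_mod m n r)%:R = residue_form m 1 r ((1 + 'X) ^+ n) :> rat.
Proof.
rewrite residue_form_binomial /binom_sum_mod natr_sum big_mkcond /=.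
apply: eq_bigr => j _; rewrite /residue_weight exp1rz.
by case: ifP; rewrite ?mul1r ?mul0r.
Qed.

Lemma alt_binom_sum_mod_form (m n : nat) (r : int) :
  (alt_binom_sum_mod m n r)%:~R = residue_form m (-1) r ((1 + 'X) ^+ n) :> rat.
Proof.
rewrite residue_form_binomial /alt_binom_sum_mod rmorph_sum big_mkcond /=.
apply: eq_bigr => j _; rewrite /residue_weight.
case: ifP; rewrite ?mul0r // => _.
by rewrite rmorphM /= rmorphXz ?rmorphN1 ?unitrN1.
Qed.

(** * The two identities *)

Theorem theorem1p2 (k : int) (m : nat) (hm : (0 < m)%N) :
  (forall i : nat, (i < m)%N ->
     c_coef m i \is a Num.int /\ d_coef m i \is a Num.int) /\
  (forall n : nat, (2 * ((m + 1) %/ 2) <= n)%N ->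
     \sum_(0 <= i < ((m + 1) %/ 2).+1)
        (-1) ^+ i * c_coef m i * (binom_sum_mod m (n - 2 * i) (k - i%:Z))%:R
     = 2 * (-1) ^ k * (m == n)%:R) /\
  (forall n : nat, (2 * (m %/ 2) <= n)%N ->
     \sum_(0 <= i < (m %/ 2).+1)
        (-1) ^+ i * d_coef m i * (alt_binom_sum_mod m (n - 2 * i) (k - i%:Z))%:~R
     = (-1) ^ k * (m - 1 == n)%N%:R).
Proof.
have constE (i c : nat) (p : {poly rat}) :
    ((-1) ^+ i * c%:R : rat) *: p = (-1) ^+ i * c%:R * p.
  by rewrite -mul_polyC polyCM rmorphXn rmorphN1 polyC_natr.
split=> [i lt_im|]; first by rewrite c_coefE ?lt_im // d_coefE // !natr_int.
split=> n le_n.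
  have waring_c : \sum_(0 <= i < ((m + 1) %/ 2).+1)
      ((-1) ^+ i * (lucas_coef2 m i)%:R)
        *: ('X^i * (1 + 'X) ^+ (m.+1 - 2 * i))
      = ('X^m - 1%:P) * ('X - 1) :> {poly rat}.
    have := @waring_lucas2 _ (1 : {poly rat}) 'X m ((m + 1) %/ 2).+1 hm.
    rewrite expr1n => <- //; apply: eq_bigr => i _.
    by rewrite constE mul1r.
  transitivity (\sum_(0 <= i < ((m + 1) %/ 2).+1)
      ((-1) ^+ i * (lucas_coef2 m i)%:R)
        * residue_form m (1 : rat) (k - i%:Z) ((1 + 'X) ^+ (n - 2 * i))).
    rewrite [LHS]big_nat [RHS]big_nat; apply: eq_bigr => i /andP[_ lt_i].
    by rewrite c_coefE ?binom_sum_mod_form //; lia.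
  have [defn|ne_mn] := eqVneq m n; last first.
    by rewrite (residue_sum_vanish _ hm _ _ waring_c) ?oner_neq0 ?mulr0 //; lia.
  have sgn_m : (1 : rat) = (-1) ^+ m.
    by rewrite -signr_odd (_ : odd m = false) //; lia.
  rewrite -defn (residue_sum_boundary _ hm sgn_m _ waring_c); last by lia.
  rewrite mulrBr mulr1 [_ * 'X]mulrC linearB /= residue_formXM.
  rewrite !(residue_form_alt _ hm sgn_m) mulr1.
  by rewrite expfzDr // -[(-1) ^ (-1)]/((-1) ^-1) invrN1; ring.
have waring_d : \sum_(0 <= i < (m %/ 2).+1)
    ((-1) ^+ i * (lucas_coef m i)%:R) *: ('X^i * (1 + 'X) ^+ (m - 2 * i))
    = ('X^m - (-1)%:P) * 1 :> {poly rat}.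
  have := @waring_lucas _ (1 : {poly rat}) 'X m (m %/ 2).+1.
  rewrite expr1n polyCN opprK polyC1 mulr1 [RHS]addrC => <- //.
  apply: eq_bigr => i _.
  by rewrite constE mul1r.
transitivity (\sum_(0 <= i < (m %/ 2).+1)
    ((-1) ^+ i * (lucas_coef m i)%:R)
      * residue_form m (-1 : rat) (k - i%:Z) ((1 + 'X) ^+ (n - 2 * i))).
  rewrite [LHS]big_nat [RHS]big_nat; apply: eq_bigr => i /andP[_ lt_i].
  by rewrite d_coefE ?alt_binom_sum_mod_form //; lia.
have [defn|ne_mn] := eqVneq (m - 1)%N n; last first.
  rewrite (residue_sum_vanish _ hm _ _ waring_d) ?oppr_eq0 ?oner_neq0 ?mulr0 //.
  by lia.
have sgn_m : (-1 : rat) = (-1) ^+ m.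
  by rewrite -signr_odd (_ : odd m = true) //; lia.
have defm : m = n.+1 by lia.
rewrite (@residue_sum_boundary _ m (-1) _ _ n 1 k hm sgn_m le_n); last first.
  by rewrite -defm.
by rewrite opprK mul1r mulr1 (residue_form_alt _ hm sgn_m) mulr1.
Qed.
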